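(* Let $L$ be a complete and completely distributive lattice, $G$ a group, $\mu$ an $L$-subgroup of $G$, and let $\eta \in L(\mu)$ be an $L$-subgroup of $\mu$. If $\eta$ is both a pronormal $L$-subgroup of $\mu$ and a subnormal $L$-subgroup of $\mu$, then $\eta$ is a normal $L$-subgroup of $\mu$.
   Context: $L$ has least element $0$ and greatest element $1$; $e$ is the identity of $G$. An $L$-subset of $G$ is a function $G \to L$; inclusion $\eta\subseteq\mu$ means $\eta(x)\le\mu(x)$ for all $x\in G$; unions and intersections of $L$-subsets are pointwise joins and meets. An $L$-subgroup of $G$ is a function $\mu: G\to L$ with $\mu(xy)\ge\mu(x)\wedge\mu(y)$ and $\mu(x^{-1})=\mu(x)$ for all $x,y\in G$; $L(G)$ is the set of these. For $\mu\in L(G)$, $L(\mu)$ denotes the set of $\eta\in L(G)$ with $\eta\subseteq\mu$ (the $L$-subgroups of $\mu$). For an $L$-subset $\theta$ of $G$, $\langle\theta\rangle$ is the smallest $L$-subgroup of $G$ containing $\theta$ (the intersection of all $L$-subgroups of $G$ containing it), and $\langle\eta,\nu\rangle=\langle\eta\cup\nu\rangle$. $L$-points: for $a\in L$, $x\in G$, the $L$-point $a_x$ is the $L$-subset with value $a$ at $x$ and $0$ elsewhere; $a_x\in\mu$ means $\mu(x)\ge a$. Conjugate: for $\eta\in L(\mu)$ and $a_z\in\mu$, $\eta^{a_z}$ is the $L$-subgroup of $\mu$ given by $\eta^{a_z}(x)=a\wedge\eta(zxz^{-1})$ for all $x\in G$. Pronormal: $\eta\in L(\mu)$ is a pronormal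 $L$-subgroup of $\mu$ if for every $L$-point $a_x\in\mu$ there exists an $L$-point $b_y\in\langle\eta,\eta^{a_x}\rangle$ such that $\eta^{b_y}=\eta^{a_x}$. Normal: for $\nu \in L(G)$, $\eta\in L(\nu)$ is a normal $L$-subgroup of $\nu$ (written $\eta\triangleleft\nu$) if $\eta(yxy^{-1})\ge\eta(x)\wedge\nu(y)$ for all $x,y\in G$. Normal closure: for $\nu\in L(G)$ and $\eta\in L(\nu)$, let $\nu\eta\nu^{-1}(x)=\bigvee_{x=zyz^{-1}}\{\eta(y)\wedge\nu(z)\}$ for $x\in G$; the normal closure of $\eta$ in $\nu$ is $\eta^{\nu}=\langle\nu\eta\nu^{-1}\rangle$. Subnormal: for $\eta\in L(\mu)$ set $\eta_0=\mu$ and $\eta_i=\eta^{\eta_{i-1}}$ for $i\ge1$ (the normal closure of $\eta$ in $\eta_{i-1}$). $\eta$ is a subnormal $L$-subgroup of $\mu$ if there is a non-negative integer $m$ such that $\eta=\eta_m\triangleleft\eta_{m-1}\triangleleft\cdots\triangleleft\eta_0=\mu$. *)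

(* Defs.v *)
From mathcomp Require Import all_boot all_order.
From mathcomp Require Import boolp classical_sets.

Set Implicit Arguments.
Unset Strict Implicit.
Unset Printing Implicit Defensive.

Import Order.TTheory.

Local Open Scope classical_set_scope.
Local Open Scope group_scope.

Section Lattice.
Context (d : Order.disp_t) (L : tbLatticeType d).

Definition complete_lattice : Prop :=
  forall A : set L, supremums A !=set0 /\ infimums A !=set0.

(* [supremum x0 A] is [x0] when [A] is empty, hence the choice of the bottom
   (resp. top) element, which is the join (resp. meet) of the empty set. *)
Definition Sup (A : set L) : L := supremum \bot%O A.
Definition Inf (A : set L) : L := infimum \top%O A.

(* The meet of the joins of the [A i] is the join, over all choice functions
   [f] of the family [A], of the meets of the values of [f]. *)
Definition completely_distributive : Prop :=
  forall (I : Type) (A : I -> set L),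
    Inf [set Sup (A i) | i in [set: I]] =
    Sup [set Inf (range f) | f in [set f : I -> L | forall i, A i (f i)]].

End Lattice.

Section LSubgroups.
Context (d : Order.disp_t) (L : tbLatticeType d) (G : groupType).
Implicit Types (eta mu nu theta : G -> L) (a : L) (x y z : G).

Definition Lsubset eta mu : Prop := forall x, (eta x <= mu x)%O.

Definition Lunion eta mu : G -> L := fun x => (eta x `|` mu x)%O.

Definition Lsubgroup mu : Prop :=
  (forall x y, (mu x `&` mu y <= mu (x * y))%O) /\
  (forall x, mu x^-1 = mu x).

(* Membership in L(mu). *)
Definition Lsubgroup_of eta mu : Prop := Lsubgroup eta /\ Lsubset eta mu.

Definition Lgen theta : G -> L :=
  fun x => Inf [set nu x | nu in [set nu | Lsubgroup nu /\ Lsubset theta nu]].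

(* The L-point a_x is represented by the pair of its height [a] and its
   support [x]; this is the relation "a_x belongs to mu". *)
Definition Lpoint_in a x mu : Prop := (a <= mu x)%O.

(* eta^{a_z} *)
Definition Lconj eta a z : G -> L :=
  fun x => (a `&` eta (z * x * z^-1))%O.

Definition pronormal eta mu : Prop :=
  Lsubgroup_of eta mu /\
  forall a x, Lpoint_in a x mu ->
    exists b y, Lpoint_in b y (Lgen (Lunion eta (Lconj eta a x))) /\
                Lconj eta b y = Lconj eta a x.

Definition normal eta nu : Prop :=
  Lsubgroup_of eta nu /\
  forall x y, (eta x `&` nu y <= eta (y * x * y^-1))%O.

(* nu eta nu^{-1} *)
Definition Lconjugates nu eta : G -> L :=
  fun x => Sup [set a | exists y z,
                  x = z * y * z^-1 /\ a = (eta y `&` nu z)%O].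

Definition normal_closure eta nu : G -> L := Lgen (Lconjugates nu eta).

Fixpoint closure_series eta mu (i : nat) : G -> L :=
  if i is j.+1 then normal_closure eta (closure_series eta mu j) else mu.

Definition subnormal eta mu : Prop :=
  Lsubgroup_of eta mu /\
  exists m : nat, eta = closure_series eta mu m /\
    forall i : nat, (i < m)%N ->
      normal (closure_series eta mu i.+1) (closure_series eta mu i).

End LSubgroups.

(* Main.v *)
Require Import Defs.
From mathcomp Require Import all_boot all_order.
From mathcomp Require Import classical_sets.

Import Order.TTheory.

Local Open Scope classical_set_scope.
Local Open Scope group_scope.

(** If [eta] is normal in [nu] and [nu] is normal in [lambda], then conjugating
    [eta] by an L-point [a_x] of [lambda] stays inside [nu], so pronormality
    yields an L-point [b_y] of [nu] with the same conjugate; as [nu] normalizes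
    [eta], that conjugate lies below [eta]. Hence [eta] is normal in [lambda],
    and one climbs the subnormal series step by step up to [mu]. *)

Section LSubgroupTheory.
Context {d : Order.disp_t} {L : tbLatticeType d} {G : groupType}
  (Lcomplete : complete_lattice L).
Implicit Types (eta mu nu lambda theta : G -> L).

Lemma Inf_le (A : set L) a : A a -> (Inf A <= a)%O.
Proof.
move=> Aa; rewrite /Inf /infimum.
case: ifPn => [/eqP A_eq0|_]; first by move: Aa; rewrite A_eq0.
case: xgetP => [x _ [lbA _]|noinf]; first exact: lbA.
(* Completeness excludes the case where [infimum] returns its default on a nonempty set. *)
by have [_ [l Al]] := Lcomplete A; case: (noinf l).
Qed.

Lemma Lgen_min theta nu :
  Lsubgroup nu -> Lsubset theta nu -> Lsubset (Lgen theta) nu.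
Proof. by move=> nuP le_nu x; apply: Inf_le; exists nu. Qed.

Lemma normal_refl eta : Lsubgroup eta -> normal eta eta.
Proof.
move=> etaP; have [etaM etaV] := etaP.
split=> [|x y]; first by split=> // x; exact: lexx.
apply: le_trans (etaM _ _); rewrite lexI etaV leIr andbT.
by apply: le_trans (etaM _ _); rewrite meetC.
Qed.

(** Conjugating [x * t * x^-1] by [x^-1] gives back [t], and [lambda x^-1 = lambda x] is at least
    [a]. *)
Lemma normal_Lconj_sub eta nu lambda a x :
  Lsubgroup lambda -> Lsubset eta nu -> normal nu lambda ->
  Lpoint_in a x lambda -> Lsubset (Lconj eta a x) nu.
Proof.
move=> [_ lambdaV] le_nu [_ nuJ] ax t; rewrite /Lconj.
have := nuJ (x * t * x^-1) x^-1.
rewrite lambdaV invgK !mulgA mulVg mul1g mulgVK; apply: le_trans.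
by rewrite meetC; apply: leI2.
Qed.

Lemma pronormal_normal_trans eta nu lambda mu :
  pronormal eta mu -> Lsubgroup lambda -> Lsubset lambda mu ->
  normal eta nu -> normal nu lambda -> normal eta lambda.
Proof.
move=> [_ eta_pro] lambdaP le_mu eta_nu nu_lambda.
have [[etaP le_nu] etaJ] := eta_nu.
have [[nuP le_lambda] _] := nu_lambda.
split=> [|s x].
  by split=> // x; apply: le_trans (le_nu x) (le_lambda x).
(* With support [x^-1] and height [lambda x], the conjugate of [eta] takes at [x * s * x^-1] exactly
   the value [eta s] meet [lambda x] to be bounded. *)
have ax : Lpoint_in (lambda x) x^-1 lambda by rewrite /Lpoint_in lambdaP.2.
have [b [y [by_in conj_eq]]] := eta_pro _ _ (le_trans ax (le_mu _)).
have by_nu : (b <= nu y)%O.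
  apply: le_trans by_in _; apply: Lgen_min => // t; rewrite leUx le_nu.
  exact: normal_Lconj_sub nu_lambda ax t.
have := congr1 (@^~ (x * s * x^-1)) conj_eq.
rewrite /Lconj !mulgA mulVg mul1g invgK mulgVK [RHS]meetC => <-.
(* Normality of [eta] in [nu] undoes the conjugation by [y], at a cost [nu y] that [b] already
   pays. *)
have := etaJ (y * x * s * x^-1 * y^-1) y^-1.
rewrite nuP.2 invgK !mulgA mulVg mul1g mulgVK; apply: le_trans.
by rewrite meetC; apply: leI2.
Qed.

End LSubgroupTheory.

Theorem theorem4p15 (d : Order.disp_t) (L : tbLatticeType d)
  (Lcomplete : complete_lattice L) (Ldistr : completely_distributive L)
  (G : groupType) (mu eta : G -> L)
  (mu_subgroup : Lsubgroup mu) (eta_subgroup : Lsubgroup_of eta mu)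
  (eta_pronormal : pronormal eta mu) (eta_subnormal : subnormal eta mu) :
  normal eta mu.
Proof.
have [_ [m [eta_eq series_normal]]] := eta_subnormal.
have seriesP i : (i <= m)%N -> Lsubgroup_of (closure_series eta mu i) mu.
  elim: i => [_|i IHi lt_im]; first by split=> // x; exact: lexx.
  have [_ le_mu] := IHi (ltnW lt_im).
  have [[? le_i] _] := series_normal i lt_im.
  by split=> // x; apply: le_trans (le_i x) (le_mu x).
(* The index descends from [m], where the series is [eta] itself, to [0], where it is [mu]. *)
suff climb i : (i <= m)%N -> normal eta (closure_series eta mu i) ->
    normal eta mu.
  by apply: (climb m) => //; rewrite -eta_eq; apply: normal_refl eta_subgroup.1.
elim: i => // i IHi lt_im eta_normal; apply: IHi; first exact: ltnW.
have [? ?] := seriesP i (ltnW lt_im).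
exact: (pronormal_normal_trans Lcomplete _ _ _ _ eta_pronormal _ _ eta_normal
  (series_normal i lt_im)).
Qed.
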